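(* Let $c\ge 0$ and $d\in\{0,1,2,\dots\}$ be fixed, let $\lambda>0$, and set $q=e^{-\lambda/N}$, $\alpha=cN+d$, $\mathsf{s}=e^{-\lambda}$. Let $N\to\infty$ along integers for which $\alpha$ is a nonnegative integer. Then for every fixed integer $p\ge 1$, $$ \lim_{N\to\infty}\frac{1}{N}m_{N,p}^{(\mathrm{qL})}=\mathcal{M}_p^{(\mathrm{qL})}:=\frac{1}{\lambda p}\sum_{m=0}^{p}\binom{p}{m}\mathsf{s}^{cm}(1-\mathsf{s}^c)^{p-m}\,I_{1-\mathsf{s}}(m+1,p). $$ Moreover, if $c=0$ (so $\alpha=d$), then for every fixed integer $p\ge 1$, as $N\to\infty$, $$ m_{N,p}^{(\mathrm{qL})}=N\,\mathcal{M}_p^{(\mathrm{qL})}\big|_{c=0}+\frac12 I_{1-\mathsf{s}}(p+1,p)+\frac{d}{2}\binom{2p}{p}\mathsf{s}^p(1-\mathsf{s})^p+O\Big(\frac1N\Big), $$ where $\mathcal{M}_p^{(\mathrm{qL})}\big|_{c=0}=\frac{1}{\lambda p}I_{1-\mathsf{s}}(p+1,p)$.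
   Context: The $q$-LUE of size $N$ with parameters $q\in(0,1)$, $\alpha>-1$ is the random configuration $(x_1,\dots,x_N)$ with each $x_j\in\{1,q,q^2,\dots\}$ and joint probability proportional to $\prod_{1\le j<k\le N}(x_j-x_k)^2\prod_{j=1}^N x_j^{\alpha}(qx_j;q)_\infty$, where $(x;q)_\infty=\prod_{k\ge0}(1-xq^k)$. Its spectral moments are $m_{N,p}^{(\mathrm{qL})}=\mathbb{E}\big[\sum_{j=1}^N x_j^p\big]$. For $a,b>0$ and $0<x<1$, $I_x(a,b)=\frac{\Gamma(a+b)}{\Gamma(a)\Gamma(b)}\int_0^x t^{a-1}(1-t)^{b-1}\,dt$ is the regularised incomplete beta function.
   Formalization: The joint probability carries an extra factor x_j for each particle (Jackson measure, weight x_j^{α+1}(qx_j;q)_∞); without it the ensemble is not normalisable at α=0 and the c=0 expansion would have d−1 in place of d. *)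

(* Defs.v *)
From HB Require Import structures.
From mathcomp Require Import all_boot all_order all_algebra.
From mathcomp Require Import all_classical all_reals all_analysis.
Set Implicit Arguments. Unset Strict Implicit. Unset Printing Implicit Defensive.
Import Order.TTheory GRing.Theory Num.Theory.
Import numFieldNormedType.Exports.
Local Open Scope classical_set_scope.
Local Open Scope ring_scope.

Section QLUE.
Variable R : realType.

Definition qpoch_inf (x q : R) : R :=
  limn (fun n : nat => \prod_(i < n) (1 - x * q ^+ i)).

(* Weight of a configuration x = (x_0,..,x_{N-1}), with x_j = q^{k_j}:
   prod_{i<j} (x_i - x_j)^2 * prod_j x_j^alpha (q x_j; q)_oo, taken with
   respect to the Jackson measure d_q x (which contributes the factor x_j
   at the lattice point x_j = q^{k_j}). *)
Definition qLUE_weight (N alpha : nat) (q : R) (x : 'I_N -> R) : R :=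
  (\prod_(i < N) \prod_(j < N | (i < j)%N) (x i - x j) ^+ 2) *
  \prod_(j < N) (x j ^+ alpha * qpoch_inf (q * x j) q * x j).

Definition qLUE_trunc (N alpha : nat) (q : R) (F : ('I_N -> R) -> R) (K : nat) : R :=
  \sum_(k : {ffun 'I_N -> 'I_K})
     F (fun j => q ^+ (k j)) * qLUE_weight alpha q (fun j => q ^+ (k j)).

(* m_{N,p} = E[ sum_j x_j^p ]: ratio of the (nonnegative-term) sums over all
   configurations in {1,q,q^2,...}^N, each computed as the limit of the
   truncations k_j < K. *)
Definition qLUE_moment (N alpha : nat) (q : R) (p : nat) : R :=
  limn (@qLUE_trunc N alpha q (fun x => \sum_(j < N) x j ^+ p)) /
  limn (@qLUE_trunc N alpha q (fun _ => 1)).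

Definition betainc (x : R) (a b : nat) : R :=
  (\int[lebesgue_measure]_(t in `[0, x]) (t ^+ a.-1 * (1 - t) ^+ b.-1)) /
  beta_fun a b.

Definition Mq (c lam : R) (p : nat) : R :=
  let s := expR (- lam) in
  (lam * p%:R)^-1 *
  \sum_(m < p.+1) ('C(p, m)%:R * (s `^ c) ^+ m * (1 - s `^ c) ^+ (p - m) *
                   betainc (1 - s) m.+1 p).

End QLUE.

(* Main.v *)
(* Multiplying the Vandermonde determinant by the power sum of degree p raises
   one of its exponents by p, so Andreief's identity writes the moment as a sum
   over i < N of ratios of Hankel-type determinants.  The moments of the little
   q-Laguerre weight are proportional to (A;q)_n with A = q^(alpha+1), which
   turns these determinants into Vandermonde determinants in the powers of q:

     m_(N,p) = sum_i (q^(alpha+1+i);q)_p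
                     prod_(j != i) (q^(i+p) - q^j) / (q^i - q^j).

   Only the last p terms survive, with coefficients those of (z;q)_(p-1), so
   that with s = q^N and G(x) = (x;q)_p (q^alpha x;q)_p

     m_(N,p) = (q;q)_p^(-1) sum_j G_j s^j (q^(1-j);q)_(p-1).

   Each factor has an explicit expansion in 1/N to second order.  The limiting
   functional sends (1-x)^(p+m) to I_(1-s)(m+1,p), as one sees by
   differentiating in s, and (1 - s^c x)^p is expanded in powers of 1 - x. *)
Require Import Defs.
From HB Require Import structures.
From mathcomp Require Import all_boot all_order all_algebra.
From mathcomp Require Import all_classical all_reals all_analysis.
From mathcomp Require Import perm ring lra.
Import Order.TTheory GRing.Theory Num.Theory.
Import numFieldNormedType.Exports.
Local Open Scope ring_scope.
Set Implicit Arguments. Unset Strict Implicit. Unset Printing Implicit Defensive.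

(** * Determinants *)

Section Determinants.
Variable F : fieldType.

Lemma andreief (N : nat) (I : finType) (f g : 'I_N -> I -> F) :
  \sum_(k : {ffun 'I_N -> I}) \det (\matrix_(i, j) f i (k j)) *
                              \det (\matrix_(i, j) g i (k j)) =
  N`!%:R * \det (\matrix_(i, j) \sum_x f i x * g j x).
Proof.
set M := \matrix_(i, j) _.
have E (h : 'I_N -> I -> F) (k : {ffun 'I_N -> I}) :
    \det (\matrix_(i, j) h i (k j)) =
    \sum_(s : 'S_N) (-1) ^+ s * \prod_j h (s j) (k j).
  rewrite -det_tr /determinant; apply: eq_bigr => s _; congr (_ * _).
  by apply: eq_bigr => j _; rewrite !mxE.
under eq_bigr => k _ do rewrite (E g) big_distrr.
rewrite exchange_big /=.
transitivity (\sum_(s : 'S_N) \det M); last first.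
  by rewrite sumr_const card_Sn mulr_natl.
apply: eq_bigr => s _.
(* The sign of [s] in the expansion of the [g] determinant cancels against the sign of permuting the
   columns of [M] by [s]. *)
have -> : \det M = (-1) ^+ s * \det (col_perm s M).
  rewrite col_permE det_mulmx det_perm odd_permV mulrC -mulrA -expr2 sqrr_sign.
  by rewrite mulr1.
rewrite -[\det (col_perm s M)]det_tr [\det (_^T)]/determinant big_distrr /=.
under eq_bigr => k _ do rewrite (E f) big_distrl.
rewrite exchange_big; apply: eq_bigr => t _ /=.
under [in RHS]eq_bigr => j _ do rewrite !mxE.
rewrite bigA_distr_bigA /= !big_distrr /=; apply: eq_bigr => k _.
by rewrite big_split /= mulrACA [RHS]mulrA [_ ^+ s * _]mulrC.
Qed.

(** In the Leibniz term of [s], scaling row [i] brings out [x (s i)], and summing over [i] gives the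
    full sum of [x] whatever [s] is. This trades a power sum times a Vandermonde determinant for
    determinants with one exponent raised. *)
Lemma sum_det_row_scale (n : nat) (V : 'M[F]_n) (x : 'I_n -> F) :
  \sum_i \det (\matrix_(a, j) (V a j * (if a == i then x j else 1))) =
  (\sum_j x j) * \det V.
Proof.
rewrite /determinant exchange_big big_distrr /=; apply: eq_bigr => s _.
rewrite -big_distrr /= mulrCA; congr (_ * _).
rewrite [\sum_j x j](reindex_inj (@perm_inj _ s)) /= big_distrl /=.
apply: eq_bigr => i _.
under eq_bigr => a _ do rewrite mxE.
rewrite big_split /= mulrC; congr (_ * _).
by rewrite -big_mkcond /= big_pred1_eq.
Qed.

(** The matrix is, up to transposition, a triangular coefficient matrix times a Vandermonde
    matrix. *)
Lemma det_poly_Vandermonde (n : nat) (P : 'I_n -> {poly F}) (z : 'I_n -> F) :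
  (forall b : 'I_n, (size (P b) <= b.+1)%N) ->
  \det (\matrix_(a, b) (P b).[z a]) =
  (\prod_b (P b)`_b) * \prod_(a < n) \prod_(b < n | (a < b)%N) (z b - z a).
Proof.
move=> szP.
pose U : 'M[F]_n := \matrix_(b, i) (P b)`_i.
have -> : \matrix_(a, b) (P b).[z a] = (U *m Vandermonde n (\row_a z a))^T.
  apply/matrixP => a b; rewrite !mxE (@horner_coef_wide _ n).
    by apply: eq_bigr => i _; rewrite !mxE.
  exact: leq_trans (szP b) (ltn_ord b).
rewrite det_tr det_mulmx det_trig; last first.
  apply/is_trig_mxP => i j ij; rewrite mxE nth_default //.
  exact: leq_trans (szP i) ij.
rewrite det_Vandermonde; congr (_ * _).
  by apply: eq_bigr => b _; rewrite mxE.
by apply: eq_bigr => a _; apply: eq_bigr => b _; rewrite !mxE.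
Qed.

(** Only the pairs containing [i] change, and the pair of [i] and [j] changes by the ratio [R j]
    whichever of the two comes first. *)
Lemma Vandermonde_prod_update (n : nat) (z : 'I_n -> F) (i : 'I_n) (y : F) :
  injective z ->
  let z' a := if a == i then y else z a in
  \prod_(a < n) \prod_(b < n | (a < b)%N) (z' b - z' a) =
  (\prod_(j < n | j != i) ((y - z j) / (z i - z j))) *
  \prod_(a < n) \prod_(b < n | (a < b)%N) (z b - z a).
Proof.
move=> injz z'.
pose R j := (y - z j) / (z i - z j).
have zN a b : a != b -> z a - z b != 0.
  by move=> ab; rewrite subr_eq0; apply: contra ab => /eqP/injz ->.
have step (a : 'I_n) : \prod_(b < n | (a < b)%N) (z' b - z' a) =
   (\prod_(b < n | (a < b)%N)
     (if a == i then R b else if b == i then R a else 1)) *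
   \prod_(b < n | (a < b)%N) (z b - z a).
  rewrite -big_split /=; apply: eq_bigr => b ab.
  have ba : b != a by rewrite -val_eqE /= gtn_eqF.
  rewrite /z' /R; case: (eqVneq a i) => [ai|ai].
    rewrite -ai (negPf ba); field; first by rewrite zN // eq_sym.
  case: (eqVneq b i) => [bi|bi]; last by rewrite mul1r.
  by rewrite -bi; field; rewrite zN.
under eq_bigr => a _ do rewrite step.
rewrite big_split /=; congr (_ * _).
(* Row [a < i] meets [i] once, at [b = i]; row [i] meets every [b > i]; the later rows do not meet
   it. *)
transitivity (\prod_(a < n) ((if (a < i)%N then R a else 1) *
    (if a == i then \prod_(b < n | (i < b)%N) R b else 1))).
  apply: eq_bigr => a _; case: (eqVneq a i) => [->|ai].
    by rewrite ltnn mul1r.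
  rewrite mulr1 -big_mkcondr /=; case: ltnP => ia.
    rewrite (big_pred1 i) // => b /=.
    by case: (eqVneq b i) => [->|]; rewrite ?ia ?andbF.
  rewrite big_pred0 // => b /=.
  by case: (eqVneq b i) => [->|]; rewrite ?andbF // ltnNge ia.
rewrite big_split /= -!big_mkcond /= big_pred1_eq.
rewrite [RHS](bigID (fun j : 'I_n => (j < i)%N)) /=; congr (_ * _).
  apply: eq_bigl => j; case: (eqVneq j i) => [->|]; by rewrite ?ltnn.
apply: eq_bigl => j; case: (eqVneq j i) => [->|]; rewrite ?ltnn //= => ji.
by move: ji; rewrite -leqNgt ltn_neqAle -(inj_eq val_inj) eq_sym /= => ->.
Qed.

End Determinants.

(** * Moments of the little q-Laguerre weight *)

Section QMoments.
Local Open Scope classical_set_scope.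
Variables (R : realType) (q : R).
Hypothesis q01 : 0 < q < 1.

Let q0 : 0 < q. Proof. by case/andP: q01. Qed.
Let q1 : q < 1. Proof. by case/andP: q01. Qed.

Let qX_ge0 n : 0 <= q ^+ n. Proof. exact/exprn_ge0/ltW. Qed.
Let qX_le1 n : q ^+ n <= 1. Proof. by rewrite exprn_ile1 ?ltW. Qed.

Let geom_sum_le n : \sum_(t < n) q ^+ t <= (1 - q)^-1.
Proof.
rewrite -[leRHS]div1r ler_pdivlMr ?subr_gt0 //.
have : (\sum_(t < n) q ^+ t) * (1 - q) = 1 - q ^+ n.
  by rewrite -[RHS]opprB subrX1; ring.
by move=> ->; rewrite gerBl.
Qed.

Definition qpoch (x y : R) (n : nat) : R := \prod_(t < n) (1 - x * y ^+ t).

Lemma qpochD (x y : R) (m n : nat) :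
  qpoch x y (m + n) = qpoch x y m * qpoch (x * y ^+ m) y n.
Proof.
rewrite /qpoch big_split_ord /=; congr (_ * _).
by apply: eq_bigr => i _; rewrite exprD mulrA.
Qed.

Lemma qpoch_ge0 x n : 0 <= x <= 1 -> 0 <= qpoch x q n.
Proof.
move=> /andP[x0 x1]; apply: prodr_ge0 => i _.
by rewrite subr_ge0 mulr_ile1.
Qed.

Lemma qpoch_noninc x : 0 <= x <= 1 ->
  {homo qpoch x q : m n / (m <= n)%N >-> n <= m}.
Proof.
move=> x01; apply/nonincreasing_seqP => n; rewrite -addn1 qpochD.
rewrite ler_piMr ?qpoch_ge0 // /qpoch big_ord1 expr0 mulr1 gerBl.
by case/andP: x01 => x0 _; rewrite mulr_ge0.
Qed.

Lemma qpoch_is_cvgn x : 0 <= x <= 1 -> cvgn (qpoch x q).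
Proof.
move=> x01; apply: nonincreasing_is_cvgn; first exact: qpoch_noninc.
by exists 0 => _ [n _ <-]; rewrite qpoch_ge0.
Qed.

Lemma qpoch_inf_ge0 x : 0 <= x <= 1 -> 0 <= qpoch_inf x q.
Proof.
move=> x01; apply: limr_ge; first exact: qpoch_is_cvgn.
by apply: nearW => n; exact: qpoch_ge0.
Qed.

Lemma qpoch_inf_le1 x : 0 <= x <= 1 -> qpoch_inf x q <= 1.
Proof.
move=> x01; have := nonincreasing_cvgn_ge (qpoch_noninc x01) (qpoch_is_cvgn x01) 0.
by rewrite {2}/qpoch big_ord0.
Qed.

Lemma qpoch_inf_rec x : 0 <= x <= 1 ->
  qpoch_inf x q = (1 - x) * qpoch_inf (x * q) q.
Proof.
move=> x01.
have xq01 : 0 <= x * q <= 1.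
  by case/andP: x01 => x0 x1; rewrite mulr_ge0 ?mulr_ile1 ?(ltW q0) ?(ltW q1).
apply/cvg_lim => //; rewrite -cvg_shiftS.
have -> : [sequence \prod_(i < n.+1) (1 - x * q ^+ i)]_n =
          (fun n => (1 - x) * qpoch (x * q) q n).
  apply/funext => n /=; have := qpochD x q 1 n.
  by rewrite add1n {1 2}/qpoch big_ord1 expr0 mulr1 expr1.
by apply: cvgMl_tmp; exact: qpoch_is_cvgn.
Qed.

(** A product of factors [1 - u_t] is at least [1] minus the sum of the [u_t], here bounded by a
    geometric series. *)
Lemma qpoch_ge1B x n : 0 <= x <= 1 -> 1 - x / (1 - q) <= qpoch x q n.
Proof.
move=> x01; have /andP[x0 x1] := x01.
have H : 1 - x * \sum_(t < n) q ^+ t <= qpoch x q n.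
  elim: n => [|n IH]; first by rewrite /qpoch !big_ord0 mulr0 subr0.
  rewrite -addn1 qpochD {2}/qpoch big_ord1 expr0 mulr1 addn1 big_ord_recr /=.
  have : qpoch x q n <= 1.
    by have := qpoch_noninc x01 (leq0n n); rewrite {2}/qpoch big_ord0.
  have : 0 <= x * q ^+ n by rewrite mulr_ge0.
  have := qpoch_ge0 n x01; nra.
apply: le_trans H; by rewrite lerB // ler_wpM2l.
Qed.

(** Once [q ^+ k < 1 - q], the bound of [qpoch_ge1B] is positive uniformly in [n]. One such [k] is
    enough to make the total mass of the weight nonzero. *)
Lemma qpoch_inf_gt0 : exists k, 0 < qpoch_inf (q * q ^+ k) q.
Proof.
have c : q ^+ k @[k --> \oo] --> (0 : R).
  by apply: cvg_expr; rewrite ger0_norm ?ltW.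
have /c : \forall y \near (0 : R), y < 1 - q.
  by apply: lt_nbhsl; rewrite subr_gt0.
move=> [k _ /(_ k (leqnn k)) /= qk]; exists k.
have x01 : 0 <= q * q ^+ k <= 1 by rewrite -exprS qX_ge0 qX_le1.
suff : 1 - q * q ^+ k / (1 - q) <= qpoch_inf (q * q ^+ k) q.
  apply: lt_le_trans; rewrite subr_gt0 ltr_pdivrMr; nra.
apply: limr_ge; first exact: qpoch_is_cvgn.
by apply: nearW => n; exact: qpoch_ge1B.
Qed.

Variable a : nat.

Let W k := qpoch_inf (q * q ^+ k) q.

Let W_ge0 k : 0 <= W k.
Proof. by apply: qpoch_inf_ge0; rewrite -exprS qX_ge0 qX_le1. Qed.
Let W_le1 k : W k <= 1.
Proof. by apply: qpoch_inf_le1; rewrite -exprS qX_ge0 qX_le1. Qed.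

(** The exponent is [a.+1 + n] and not [a + n] because the Jackson measure contributes one more
    factor [q ^+ k]. *)
Definition qmom_trunc (n K : nat) : R :=
  \sum_(k < K) (q ^+ k) ^+ (a.+1 + n) * qpoch_inf (q * q ^+ k) q.

Definition qmom (n : nat) : R := limn (qmom_trunc n).

Let qmom_trunc_nondec n :
  {homo qmom_trunc n : m k / (m <= k)%N >-> m <= k}.
Proof.
apply/nondecreasing_seqP => K; rewrite /qmom_trunc big_ord_recr /= lerDl.
by apply: mulr_ge0; [rewrite exprn_ge0 | exact: W_ge0].
Qed.

Lemma qmom_trunc_cvgn n : qmom_trunc n @ \oo --> qmom n.
Proof.
apply: nondecreasing_is_cvgn; first exact: qmom_trunc_nondec.
exists (1 - q)^-1 => _ [K _ <-].
apply: (@le_trans _ _ (\sum_(k < K) q ^+ k)).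
  apply: ler_sum => k _; rewrite -[leRHS]mulr1.
  apply: ler_pM; [by rewrite exprn_ge0 | exact: W_ge0 | | exact: W_le1].
  by rewrite addSn exprS ler_piMr // exprn_ile1.
exact: geom_sum_le.
Qed.

(* Summation by parts, using [(q^k; q)_oo = (1 - q^k) (q^(k+1); q)_oo]. *)
Lemma qmom_rec n : qmom n.+1 = (1 - q ^+ (a.+1 + n)) * qmom n.
Proof.
have E K : qmom_trunc n.+1 K.+1 =
           qmom_trunc n K.+1 - q ^+ (a.+1 + n) * qmom_trunc n K.
  apply/eqP; rewrite eq_sym subr_eq addrC -subr_eq; apply/eqP.
  rewrite /qmom_trunc -sumrB big_ord_recl /= !expr0 !expr1n subrr add0r.
  rewrite big_distrr /=; apply: eq_bigr => k _ /=; rewrite /bump /= add1n.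
  rewrite (qpoch_inf_rec (x := q * q ^+ k)); last first.
    by rewrite -exprS qX_ge0 qX_le1.
  rewrite addnS (exprS q k); set m := (a.+1 + n)%N; set x := q ^+ k.
  by rewrite (_ : q * (q * x) = q * x * q) 1?exprS ?exprMn; ring.
apply/cvg_lim => //; rewrite -cvg_shiftS.
have -> : [sequence qmom_trunc n.+1 n0.+1]_n0 =
    (fun K => qmom_trunc n K.+1 - q ^+ (a.+1 + n) * qmom_trunc n K).
  by apply/funext => K; exact: E.
rewrite mulrBl mul1r; apply: cvgB.
  by have := qmom_trunc_cvgn (n := n); rewrite -(cvg_shiftS (qmom_trunc n)); apply.
by apply: cvgMl_tmp; exact: qmom_trunc_cvgn.
Qed.

Lemma qmomE n : qmom n = qmom 0 * qpoch (q ^+ a.+1) q n.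
Proof.
elim: n => [|n IH]; first by rewrite /qpoch big_ord0 mulr1.
by rewrite qmom_rec IH /qpoch big_ord_recr /= exprD; ring.
Qed.

Lemma qmom0_neq0 : qmom 0 != 0.
Proof.
have [k Wk] := qpoch_inf_gt0; rewrite gt_eqF //.
apply: (@lt_le_trans _ _ (qmom_trunc 0 k.+1)).
  rewrite /qmom_trunc big_ord_recr /= ltr_wpDl //.
    apply: sumr_ge0 => i _.
    by apply: mulr_ge0; [rewrite exprn_ge0 | exact: W_ge0].
  by rewrite mulr_gt0 // !exprn_gt0.
apply: (@nondecreasing_cvgn_le _ (qmom_trunc 0)); first exact: qmom_trunc_nondec.
apply/cvg_ex; exists (qmom 0); exact: qmom_trunc_cvgn.
Qed.

End QMoments.

(** * The spectral moment at finite size *)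

Section FiniteN.
Local Open Scope classical_set_scope.
Variable R : realType.

Lemma cvg_det (n : nat) (f : nat -> 'M[R]_n) (M : 'M[R]_n) :
  (forall i j, f K i j @[K --> \oo] --> M i j) ->
  \det (f K) @[K --> \oo] --> \det M.
Proof.
move=> fM; apply: cvg_big => [|s _]; first exact: add_continuous.
apply: cvgMl_tmp; apply: cvg_big => [|i _]; first exact: mul_continuous.
exact: fM.
Qed.

Lemma det_col_scale (n : nat) (A : 'M[R]_n) (c : 'I_n -> R) :
  \det (\matrix_(i, j) (A i j * c j)) = \det A * \prod_j c j.
Proof.
have := mul_mx_diag A (\row_j c j).
under [RHS]eq_mx do rewrite mxE.
by move=> <-; rewrite det_mulmx det_diag; under eq_bigr do rewrite mxE.
Qed.

Lemma size_qpoch_factors (n : nat) (c : 'I_n -> R) : (forall t, c t != 0) ->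
  size (\prod_(t < n) (1 - c t *: 'X) : {poly R}) = n.+1.
Proof.
move=> c0.
have sz t : size (1 - c t *: 'X : {poly R}) = 2%N.
  rewrite addrC size_polyDl ?size_polyN ?size_scale ?size_polyX ?c0 //.
  by rewrite size_poly1.
rewrite size_prod; last by move=> t _; rewrite -size_poly_eq0 sz.
under eq_bigr do rewrite sz.
by rewrite sum_nat_const card_ord muln2 -addnn -addSn addnK.
Qed.

Variables (q : R) (a : nat).
Hypothesis q01 : 0 < q < 1.

Let q0 : 0 < q. Proof. by case/andP: q01. Qed.
Let q1 : q < 1. Proof. by case/andP: q01. Qed.

(** Andreief's identity with the one-point weight absorbed into the first family. The row exponents
    [l] stay free, so that one statement serves the normalisation and the raised exponents alike. *)
Let sum_trunc_det (N : nat) (l : 'I_N -> nat) (K : nat) :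
  \sum_(k : {ffun 'I_N -> 'I_K})
     \det (\matrix_(i < N, j < N) (q ^+ k j) ^+ l i) *
     \det (\matrix_(i < N, j < N) (q ^+ k j) ^+ i) *
     \prod_(j < N) ((q ^+ k j) ^+ a * qpoch_inf (q * q ^+ k j) q * q ^+ k j) =
  N`!%:R * \det (\matrix_(i, j) qmom_trunc q a (l i + j) K).
Proof.
pose w (k : 'I_K) := (q ^+ k) ^+ a * qpoch_inf (q * q ^+ k) q * q ^+ k.
have -> : \matrix_(i, j) qmom_trunc q a (l i + j) K =
    \matrix_(i < N, j < N) \sum_(x < K) ((q ^+ x) ^+ l i * w x) * (q ^+ x) ^+ j.
  apply/matrixP => i j; rewrite !mxE; apply: eq_bigr => x _.
  by rewrite /w addSn exprS !exprD; ring.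
rewrite -andreief; apply: eq_bigr => k _; rewrite mulrAC; congr (_ * _).
rewrite -det_col_scale; congr (\det _).
by apply/matrixP => i j; rewrite !mxE.
Qed.

Let weight_det (N : nat) (x : 'I_N -> R) :
  qLUE_weight a q x =
  \det (\matrix_(i < N, j < N) x j ^+ i) * \det (\matrix_(i < N, j < N) x j ^+ i) *
  \prod_(j < N) (x j ^+ a * qpoch_inf (q * x j) q * x j).
Proof.
rewrite /qLUE_weight; congr (_ * _).
have -> : \matrix_(i < N, j < N) x j ^+ i = Vandermonde N (\row_j x j).
  by apply/matrixP => i j; rewrite !mxE.
rewrite det_Vandermonde -big_split /=; apply: eq_bigr => i _.
rewrite -big_split /=; apply: eq_bigr => j _.
by rewrite !mxE -expr2 -sqrrN opprB.
Qed.

Let trunc1E (N K : nat) :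
  @qLUE_trunc R N a q (fun _ => 1) K =
  N`!%:R * \det (\matrix_(i < N, j < N) qmom_trunc q a (i + j) K).
Proof.
rewrite -(sum_trunc_det (fun i => nat_of_ord i)); apply: eq_bigr => k _.
by rewrite mul1r weight_det.
Qed.

Let shift (N p : nat) (i b : 'I_N) : nat := (b + (if b == i then p else 0))%N.

Let truncpE (N p K : nat) :
  @qLUE_trunc R N a q (fun x => \sum_(j < N) x j ^+ p) K =
  \sum_(i < N) N`!%:R *
     \det (\matrix_(b < N, j < N) qmom_trunc q a (shift p i b + j) K).
Proof.
under [RHS]eq_bigr do rewrite -sum_trunc_det.
rewrite exchange_big /=; apply: eq_bigr => k _.
rewrite weight_det mulrA mulrA -!big_distrl /=; congr (_ * _ * _).
rewrite -sum_det_row_scale; apply: eq_bigr => i _; congr (\det _).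
apply/matrixP => b j; rewrite !mxE exprD /shift.
by case: (b == i); rewrite ?expr0.
Qed.

Let A := q ^+ a.+1.

(** The part of the moment determinant that does not depend on the row exponents, hence cancels in
    every ratio. *)
Let const (N : nat) : R := qmom q a 0 ^+ N *
  \prod_(j < N) (\prod_(t < j) (1 - (A * q ^+ t) *: 'X) : {poly R})`_j.

(* [qmom (l + j)] factors as [qmom 0 * (A; q)_l * (A q^l; q)_j], whose last
   factor is a polynomial of degree [j] in [q^l]. *)
Let det_qmom (N : nat) (l : 'I_N -> nat) :
  \det (\matrix_(i < N, j < N) qmom q a (l i + j)) =
  const N * (\prod_i qpoch A q (l i)) *
  \prod_(i < N) \prod_(j < N | (i < j)%N) (q ^+ l j - q ^+ l i).
Proof.
pose P (j : 'I_N) : {poly R} := \prod_(t < j) (1 - (A * q ^+ t) *: 'X).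
have -> : \matrix_(i < N, j < N) qmom q a (l i + j) =
   (\matrix_(i < N, j < N) ((\matrix_(b, e) (P e).[q ^+ l b])^T i j *
                            (qmom q a 0 * qpoch A q (l j))))^T.
  apply/matrixP => i j; rewrite !mxE (qmomE q01) qpochD -/A mulrA [LHS]mulrC.
  congr (_ * _); rewrite horner_prod; apply: eq_bigr => t _.
  by rewrite !hornerE; ring.
rewrite det_tr det_col_scale det_tr det_poly_Vandermonde.
  by rewrite big_split /= prodr_const card_ord /const; ring.
move=> j; rewrite size_qpoch_factors // => t.
by rewrite mulf_neq0 // expf_neq0 ?gt_eqF.
Qed.

Let qX_inj : injective (fun n : nat => q ^+ n).
Proof.
move=> m n /= E; apply/eqP; rewrite eqn_leq.
have le i j : q ^+ i = q ^+ j -> (i <= j)%N.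
  by move=> e; rewrite leqNgt; apply/negP => ij; move: e; apply/eqP;
     rewrite lt_eqF // ltr_iXn2l.
by rewrite !le.
Qed.

Let oneB_Aq_neq0 i t : 1 - A * q ^+ i * q ^+ t != 0.
Proof.
by rewrite gt_eqF // subr_gt0 /A -!exprD addSn exprn_ilt1 ?ltW.
Qed.

Let det_qmom_neq0 N : \det (\matrix_(i < N, j < N) qmom q a (i + j)) != 0.
Proof.
rewrite det_qmom !mulf_neq0 //.
- exact/expf_neq0/qmom0_neq0.
- apply/prodf_neq0 => j _.
  (* Each [P] has degree exactly [j], so the coefficient in question is its leading one. *)
  set P := \prod_(t < j) _.
  have szP : size P = j.+1.
    by rewrite size_qpoch_factors // => t; rewrite mulf_neq0 // expf_neq0 ?gt_eqF.
  have -> : P`_j = lead_coef P by rewrite lead_coefE szP.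
  by rewrite lead_coef_eq0 -size_poly_eq0 szP.
- apply/prodf_neq0 => i _; apply/prodf_neq0 => t _.
  by have := oneB_Aq_neq0 0 t; rewrite mulr1.
- apply/prodf_neq0 => i _; apply/prodf_neq0 => j ij.
  by rewrite subr_eq0; apply: contraTneq ij => /qX_inj ->; rewrite ltnn.
Qed.

(** Determinants are continuous in their entries, so the truncations pass to the limit. In the ratio
    of determinants [const] cancels, the Pochhammer factors differ only in row [i], and the
    Vandermonde products differ by the update of one node. *)
Lemma qLUE_momentE N p :
  qLUE_moment N a q p =
  \sum_(i < N) qpoch (q ^+ (a.+1 + i)) q p *
     \prod_(j < N | j != i) ((q ^+ (i + p) - q ^+ j) / (q ^+ i - q ^+ j)).
Proof.
have cvg_tr (l : 'I_N -> nat) :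
    N`!%:R * \det (\matrix_(b < N, j < N) qmom_trunc q a (l b + j) K)
      @[K --> \oo] --> N`!%:R * \det (\matrix_(b < N, j < N) qmom q a (l b + j)).
  apply: cvgMl_tmp; apply: cvg_det => i j.
  by under eq_fun do rewrite mxE; rewrite mxE; exact: qmom_trunc_cvgn.
have l1 : limn (@qLUE_trunc R N a q (fun _ => 1)) =
    N`!%:R * \det (\matrix_(i < N, j < N) qmom q a (i + j)).
  apply/cvg_lim => //; rewrite (funext (trunc1E N)).
  exact: (cvg_tr (fun i => nat_of_ord i)).
have lp : limn (@qLUE_trunc R N a q (fun x => \sum_(j < N) x j ^+ p)) =
    \sum_(i < N) N`!%:R * \det (\matrix_(b < N, j < N) qmom q a (shift p i b + j)).
  apply/cvg_lim => //; rewrite (funext (truncpE N p)).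
  by apply: cvg_big => [|i _]; [exact: add_continuous | exact: cvg_tr].
rewrite /qLUE_moment l1 lp big_distrl /=; apply: eq_bigr => i _.
have N0 : (N`!%:R : R) != 0 by rewrite pnatr_eq0 -lt0n fact_gt0.
have D0 := det_qmom_neq0 N.
apply: (canLR (mulfK (mulf_neq0 N0 D0))); rewrite mulrCA; congr (_ * _).
rewrite !det_qmom.
have -> : \prod_(b < N) qpoch A q (shift p i b) =
    qpoch (q ^+ (a.+1 + i)) q p * \prod_(b < N) qpoch A q b.
  rewrite /shift; under eq_bigr => b _.
    rewrite qpochD (_ : qpoch _ q (if _ then _ else _) =
      if b == i then qpoch (q ^+ (a.+1 + b)) q p else 1); first over.
    by case: (b == i); rewrite ?exprD // /qpoch big_ord0.
  by rewrite big_split /= -big_mkcond /= big_pred1_eq mulrC.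
have := @Vandermonde_prod_update _ N (fun b => q ^+ b) i (q ^+ (i + p)).
move=> /(_ (inj_comp qX_inj val_inj)) /= V.
have W (b : 'I_N) : q ^+ shift p i b = if b == i then q ^+ (i + p) else q ^+ b.
  by rewrite /shift; case: eqVneq => [->|_]; rewrite ?addn0.
under [X in _ * X = _]eq_bigr do under eq_bigr do rewrite !W.
rewrite V; ring.
Qed.

End FiniteN.

(** * Resummation of the finite-size formula as a polynomial in [q ^+ N] *)

Section Resummation.
Variable R : realType.

Definition qpoch_poly (q c : R) (n : nat) : {poly R} :=
  \prod_(t < n) (1 - (c * q ^+ t) *: 'X).

Lemma horner_qpoch_poly (q c : R) (n : nat) (x : R) :
  (qpoch_poly q c n).[x] = qpoch (c * x) q n.
Proof.
by rewrite horner_prod; apply: eq_bigr => t _; rewrite !hornerE; ring.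
Qed.

Lemma qpoch_polyS (q c : R) (n : nat) :
  qpoch_poly q c n.+1 = qpoch_poly q c n * (1 - (c * q ^+ n) *: 'X).
Proof. by rewrite /qpoch_poly big_ord_recr. Qed.

Lemma size_qpoch_poly_le (q c : R) (n : nat) :
  (size (qpoch_poly q c n) <= n.+1)%N.
Proof.
elim: n => [|n IH]; first by rewrite /qpoch_poly big_ord0 size_poly1.
rewrite qpoch_polyS; apply: leq_trans (size_polyMleq _ _) _.
have sz : (size (1 - (c * q ^+ n) *: 'X : {poly R})%R <= 2)%N.
  apply: leq_trans (size_polyD _ _) _; rewrite size_poly1 geq_max /= size_polyN.
  by rewrite (leq_trans (size_scale_leq _ _)) ?size_polyX.
by rewrite -subn1 leq_subLR add1n; apply: leq_trans (leq_add IH sz) _; rewrite addn2.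
Qed.

Lemma coef_qpoch_polyS (q c : R) (n k : nat) :
  (qpoch_poly q c n.+1)`_k =
  (qpoch_poly q c n)`_k -
  (if k is k'.+1 then c * q ^+ n * (qpoch_poly q c n)`_k' else 0).
Proof.
rewrite qpoch_polyS mulrBr mulr1 coefB -scalerAr coefZ coefMX.
by case: k => [|k] //=; rewrite mulr0.
Qed.

Lemma coef0_qpoch_poly (q c : R) (n : nat) : (qpoch_poly q c n)`_0 = 1.
Proof.
elim: n => [|n IH]; first by rewrite /qpoch_poly big_ord0 coef1.
by rewrite coef_qpoch_polyS subr0.
Qed.

(** This is the coefficient form of (1 - z) (qz;q)_n = (1 - q^n z) (z;q)_n, the recurrence behind
    the q-binomial theorem; it is proved by induction on [n]. *)
Lemma coef_qpoch_poly_rec (q : R) (n k : nat) :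
  (qpoch_poly q 1 n)`_k.+1 * (1 - q ^+ k.+1) =
  - (qpoch_poly q 1 n)`_k * (q ^+ k - q ^+ n).
Proof.
elim: n k => [|n IH] k.
  rewrite /qpoch_poly big_ord0 !coef1 /=; case: k => [|k] /=; rewrite ?expr0; ring.
rewrite !coef_qpoch_polyS mul1r; case: k => [|k].
  have := IH 0; rewrite !exprS !expr0; nra.
have := IH k; have := IH k.+1; rewrite !exprS.
move: (_`_k.+2) (_`_k.+1) (_`_k) (q ^+ k) (q ^+ n) => e2 e1 e0 x y H2 H1.
have -> : (e2 - y * e1) * (1 - q * (q * x)) =
  e2 * (1 - q * (q * x)) - y * e1 * (1 - q * (q * x)) by ring.
rewrite H2.
have -> : - (e1 - y * e0) * (q * x - q * y) =
  - e1 * (q * x - q * y) - q * y * (- e0 * (x - y)) by ring.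
rewrite -H1; ring.
Qed.

Variables (q : R) (a : nat).
Hypothesis q01 : 0 < q < 1.

Let q0 : 0 < q. Proof. by case/andP: q01. Qed.
Let q1 : q < 1. Proof. by case/andP: q01. Qed.

Let qN0 n : q ^+ n != 0. Proof. by rewrite expf_neq0 ?gt_eqF. Qed.

Let BqX_neq0 n : 1 - q ^+ n.+1 != 0.
Proof. by rewrite gt_eqF // subr_gt0 exprn_ilt1 ?ltW. Qed.

Lemma qpoch_qq_neq0 n : qpoch q q n != 0.
Proof. by apply/prodf_neq0 => t _; rewrite -exprS. Qed.

Lemma coef_qpoch_polyE (n k : nat) :
  (qpoch_poly q 1 n)`_k =
  \prod_(t < k) (- (q ^+ t - q ^+ n) / (1 - q ^+ t.+1)).
Proof.
elim: k => [|k IH]; first by rewrite big_ord0 coef0_qpoch_poly.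
rewrite big_ord_recr /= -IH; apply: (mulIf (BqX_neq0 k)).
rewrite coef_qpoch_poly_rec; field; exact: BqX_neq0.
Qed.

(** Both sides are the q-binomial coefficient of [i + p] over [p]; the right side has a number of
    factors that does not grow with [i]. *)
Let prod_below (i p : nat) :
  \prod_(0 <= j < i) ((q ^+ (i + p) - q ^+ j) / (q ^+ i - q ^+ j)) =
  qpoch (q ^+ i.+1) q p / qpoch q q p.
Proof.
elim: i => [|i IH]; first by rewrite big_geq // expr1 divff // qpoch_qq_neq0.
rewrite big_nat_recl //=.
have -> : \prod_(0 <= j < i)
    ((q ^+ (i.+1 + p) - q ^+ j.+1) / (q ^+ i.+1 - q ^+ j.+1)) =
    qpoch (q ^+ i.+1) q p / qpoch q q p.
  rewrite -IH; apply: eq_big_nat => j /andP[_ ji]; rewrite addSn !exprS -!mulrBr.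
  by rewrite -mulf_div divff ?mul1r // gt_eqF.
(* Two ways of splitting one factor off (q^(i+1);q)_(p+1): the last or the first. *)
have E : qpoch (q ^+ i.+1) q p * (1 - q ^+ i.+1 * q ^+ p) =
    (1 - q ^+ i.+1) * qpoch (q ^+ i.+2) q p.
  have := qpochD (q ^+ i.+1) q 1 p; rewrite addnC qpochD.
  by rewrite {2 3}/qpoch !big_ord1 expr0 expr1 !mulr1 -exprSr.
have -> : qpoch (q ^+ i.+2) q p =
    qpoch (q ^+ i.+1) q p * (1 - q ^+ i.+1 * q ^+ p) / (1 - q ^+ i.+1).
  by rewrite E [_ * qpoch _ _ _]mulrC mulfK.
rewrite expr0 exprD; move: (BqX_neq0 i) (qpoch_qq_neq0 p) => x1 c0.
by field; rewrite x1 c0 -opprB oppr_eq0.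
Qed.

(** With [j = i.+1 + t], each factor is [q] times the ratio of consecutive coefficients of (z;q)_n.
    The product vanishes for [k > n], which is why only the last [n.+1] indices matter. *)
Let prod_above (i n k : nat) :
  \prod_(i.+1 <= j < (i.+1 + k)%N) ((q ^+ (i + n.+1) - q ^+ j) / (q ^+ i - q ^+ j)) =
  q ^+ k * (qpoch_poly q 1 n)`_k.
Proof.
rewrite -{1}[i.+1]add0n big_addn addKn big_mkord coef_qpoch_polyE.
have -> : q ^+ k = \prod_(t < k) q by rewrite prodr_const card_ord.
rewrite -big_split /=; apply: eq_bigr => t _.
have x1 := BqX_neq0 t; have y0 := qN0 i; rewrite exprS in x1.
rewrite !addnS [q ^+ (i + n).+1]exprS [q ^+ (t + i).+1]exprS !exprD exprS.
field; rewrite x1 /=.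
have -> : q ^+ i - q * (q ^+ t * q ^+ i) = q ^+ i * (1 - q * q ^+ t) by ring.
by rewrite mulf_neq0.
Qed.

(** Setting [i = N - k.+1] turns the summand into [G.[q ^+ N / q ^+ k]] times [q ^+ k] and a
    coefficient of [E]. Expanding [G] and exchanging the sums leaves, for each [j], the value of [E]
    at q^(1-j). *)
Lemma qLUE_moment_resummed (N n K : nat) : (n < N)%N -> ((n.+1).*2 < K)%N ->
  qLUE_moment N a q n.+1 =
  (qpoch q q n.+1)^-1 *
  \sum_(j < K)
     (qpoch_poly q 1 n.+1 * qpoch_poly q (q ^+ a) n.+1)`_j *
     (q ^+ N) ^+ j * qpoch (q / q ^+ j) q n.
Proof.
move=> nN nK; set G := _ * qpoch_poly q _ _; set E := qpoch_poly q 1 n.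
rewrite (qLUE_momentE _ q01).
transitivity (\sum_(k < N) (qpoch q q n.+1)^-1 *
    (G.[q ^+ N / q ^+ k] * (q ^+ k * E`_k))).
  rewrite (reindex_inj rev_ord_inj) /=; apply: eq_bigr => k _.
  have kN := ltn_ord k; set i := (N - k.+1)%N.
  have Ni : N = (i.+1 + k)%N by rewrite /i addSnnS subnK.
  have iN : (i < N)%N by rewrite Ni addSn ltnS leq_addr.
  have -> : q ^+ N / q ^+ k = q ^+ i.+1 by rewrite [X in q ^+ X / _]Ni exprD mulfK.
  have -> : \prod_(j < N | j != rev_ord k)
      ((q ^+ (i + n.+1) - q ^+ j) / (q ^+ i - q ^+ j)) =
      (qpoch (q ^+ i.+1) q n.+1 / qpoch q q n.+1) * (q ^+ k * E`_k).
    rewrite -prod_below -(prod_above i).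
    rewrite -(big_mkord (fun j => j != i)
      (fun j => (q ^+ (i + n.+1) - q ^+ j) / (q ^+ i - q ^+ j))).
    rewrite (@big_cat_nat _ _ _ i) //=; last exact: ltnW.
    rewrite [X in _ * X](@big_cat_nat _ _ _ i.+1) //=.
    rewrite [X in _ * (X * _)]big_ltn_cond // eqxx /= [X in _ * (X * _)]big_geq // mul1r.
    rewrite -Ni; congr (_ * _); rewrite big_nat_cond [RHS]big_nat_cond;
      apply: eq_bigl => j; case: (eqVneq j i) => [->|]; rewrite ?ltnn ?andbF ?andbT //.
  rewrite hornerM !horner_qpoch_poly mul1r -exprD addSn addnS; ring.
rewrite -big_distrr /=; congr (_ * _).
have szG : (size G <= K)%N.
  apply: leq_trans nK; apply: leq_trans (size_polyMleq _ _) _.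
  rewrite -subn1 leq_subLR -addnn add1n -addnS -addSn; exact/leq_add/size_qpoch_poly_le/size_qpoch_poly_le.
under eq_bigr do rewrite (horner_coef_wide _ szG) big_distrl /=.
rewrite exchange_big /=; apply: eq_bigr => j _.
(* The degree of [E] is at most [n < N], so the sum over [k < N] contains all its coefficients. *)
have <- : E.[q / q ^+ j] = qpoch (q / q ^+ j) q n.
  by rewrite horner_qpoch_poly mul1r.
rewrite (@horner_coef_wide _ N); last first.
  exact: leq_trans (size_qpoch_poly_le _ _ _) nN.
rewrite big_distrr; apply: eq_bigr => k _ /=.
rewrite !exprMn !exprVn -!exprM (mulnC k j).
by field; rewrite qN0.
Qed.

End Resummation.

(** * The incomplete beta function *)

Section IncompleteBeta.
Variable R : realType.

(* The limit as [q -> 1] of [(q^(1-j); q)_n / (q; q)_n]. *)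
Definition binom_weight (n j : nat) : R :=
  \prod_(t < n) ((t.+1%:R - j%:R) / t.+1%:R).

Lemma binom_weight0 n : binom_weight n 0 = 1.
Proof. by apply: big1 => t _; rewrite subr0 divff ?pnatr_eq0. Qed.

(** The numerators become [t - i], hence a signed falling factorial, which vanishes for [i < n]. *)
Lemma binom_weightS n i :
  binom_weight n i.+1 = (-1) ^+ n * (i ^_ n)%:R / n`!%:R.
Proof.
elim: n => [|n IH]; first by rewrite /binom_weight big_ord0 !expr0 divr1 mulr1.
rewrite /binom_weight big_ord_recr /= -/(binom_weight n i.+1) IH.
have f0 : (n`!%:R : R) != 0 by rewrite pnatr_eq0 -lt0n fact_gt0.
rewrite factS natrM exprS ffactnSr natrM.
case: (ltnP i n) => [lin|nlei].
  by rewrite ffact_small // !(mul0r, mulr0).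
rewrite natrB //.
have -> : (n.+1%:R - i.+1%:R : R) = n%:R - i%:R by rewrite -!natr1; ring.
by field; rewrite f0 /= nat1r pnatr_eq0.
Qed.

(** The limiting functional as a diagonal operator on polynomials; its value on [P] is read at the
    point [s]. *)
Definition beta_poly (n : nat) (P : {poly R}) : {poly R} :=
  \poly_(j < size P) (binom_weight n j * P`_j).

Lemma coef_beta_poly n P j : (beta_poly n P)`_j = binom_weight n j * P`_j.
Proof.
by rewrite coef_poly; case: ltnP => // szP; rewrite [P`_j]nth_default ?mulr0.
Qed.

Lemma horner_beta_poly n (P : {poly R}) x K : (size P <= K)%N ->
  (beta_poly n P).[x] = \sum_(j < K) binom_weight n j * P`_j * x ^+ j.
Proof.
move=> szP; rewrite (@horner_coef_wide _ K).
  by apply: eq_bigr => j _; rewrite coef_beta_poly.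
exact: leq_trans (size_poly _ _) szP.
Qed.

(** The factor [i.+1] from differentiation completes the falling factorial of [i] to one of order
    [n.+1], which is what an iterated derivative produces. *)
Lemma deriv_beta_poly n (P : {poly R}) :
  (beta_poly n P)^`() = ((-1) ^+ n / n`!%:R) *: ('X^n * P^`(n.+1)).
Proof.
apply/polyP => i; rewrite coef_deriv coef_beta_poly coefZ coefXnM coef_derivn.
rewrite binom_weightS; case: ltnP => [lin|nlei].
  by rewrite ffact_small // !(mul0r, mulr0) mul0rn.
rewrite addSn subnKC // ffactSS -[LHS]mulr_natl -[P`__ *+ _]mulr_natl natrM.
by ring.
Qed.

Lemma derivn_1subX (r m : nat) :
  (((1 - 'X) ^+ (r + m))^`(r) : {poly R}) =
  ((-1) ^+ r * ((r + m) ^_ r)%:R) *: (1 - 'X) ^+ m.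
Proof.
elim: r m => [|r IH] m; first by rewrite derivn0 expr0 mulr1 scale1r.
rewrite derivnS addSnnS IH derivZ deriv_exp derivB derivC derivX sub0r /=.
rewrite ffactnSr addKn natrM exprS !mulN1r.
rewrite -[(- _) *+ _]scaler_nat -[- ((1 - 'X) ^+ m)]scaleN1r !scalerA.
by congr (_ *: _); ring.
Qed.

(** The constant collapses to (n+m+1)! / (m! n!), so the derivative is minus the normalised beta
    density read at [1 - s]. *)
Lemma deriv_beta_poly_1subX (n m : nat) :
  (beta_poly n ((1 - 'X) ^+ (n.+1 + m)))^`() =
  - (beta_fun m.+1 n.+1)^-1 *: ('X^n * (1 - 'X) ^+ m).
Proof.
rewrite deriv_beta_poly derivn_1subX -scalerAr scalerA; congr (_ *: _).
rewrite beta_fun_fact natrM invf_div.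
have := ffact_fact (leq_addr m n.+1); rewrite addKn => /(congr1 (fun k => k%:R : R)).
rewrite natrM -addSn addnC addSn addnS [(m + n)%N]addnC => <-.
have f0 k : (k`!%:R : R) != 0 by rewrite pnatr_eq0 -lt0n fact_gt0.
have : (-1) ^+ n * (-1) ^+ n = 1 :> R by rewrite -expr2 sqrr_sign.
rewrite exprS.
move: ((-1) ^+ n) (_ ^_ _) (f0 n) (f0 m) => e C n0 m0 e2.
transitivity (- (e * e) * (C%:R / n`!%:R)); first by ring.
by rewrite e2; field; rewrite n0 m0.
Qed.

Lemma Rintegral_monem (n m : nat) (x : R) : 0 < x ->
  (\int[lebesgue_measure]_(t in `[0, x]) (t ^+ m * (1 - t) ^+ n))%R =
  beta_fun m.+1 n.+1 *
  ((beta_poly n ((1 - 'X) ^+ (n.+1 + m))).[1 - x] -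
   (beta_poly n ((1 - 'X) ^+ (n.+1 + m))).[1]).
Proof.
move=> x0.
set F := beta_poly n _; set B := beta_fun _ _.
(* An explicit antiderivative of the beta integrand, by the preceding derivative formula and the
   chain rule. *)
pose H : {poly R} := B *: (F \Po (1 - 'X)).
pose f : {poly R} := 'X^m * (1 - 'X) ^+ n.
have HE y : H.[y] = B * F.[1 - y] by rewrite !hornerE horner_comp !hornerE.
have H' : H^`() = f.
  have B0 : B != 0 by rewrite gt_eqF // beta_fun_gt0.
  rewrite derivZ deriv_comp derivB derivC derivX sub0r mulrN1 deriv_beta_poly_1subX.
  rewrite comp_polyZ scalerN scalerA mulrN mulfV // scaleN1r opprK.
  have cX : (1 - 'X) \Po (1 - 'X) = 'X :> {poly R}.
    by rewrite comp_polyB comp_polyX -{1}polyC1 comp_polyC polyC1 opprB addrC subrK.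
  by rewrite comp_polyM comp_Xn_poly rmorphXn /= cX mulrC.
have -> : (fun t : R => t ^+ m * (1 - t) ^+ n) = horner f.
  by apply/funext => t; rewrite /f !hornerE.
rewrite /Rintegral (@continuous_FTC2 _ _ (horner H)) //=.
- by rewrite !HE subr0 mulrBr.
- by apply/continuous_subspaceT => t; exact: continuous_horner.
- split=> [t _| |]; first exact: derivable_horner.
  + by apply: cvg_at_right_filter; exact: continuous_horner.
  + by apply: cvg_at_left_filter; exact: continuous_horner.
- by move=> t _; rewrite -derivE H'.
Qed.

Lemma betaincE (n m : nat) (s : R) : s < 1 ->
  betainc (1 - s) m.+1 n.+1 = (beta_poly n ((1 - 'X) ^+ (n.+1 + m))).[s].
Proof.
move=> s1; set F := beta_poly n _.
have B0 : beta_fun m.+1 n.+1 != 0 :> R by rewrite gt_eqF // beta_fun_gt0.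
have F0 : F.[0] = 1.
  rewrite horner_coef0 coef_beta_poly binom_weight0 mul1r -horner_coef0.
  by rewrite !hornerE subr0 expr1n.
(* The integral over the whole of [[0, 1]] is the beta function itself, which forces [F.[0] - F.[1]
   = 1]. *)
have F1 : F.[1] = 0.
  have E : beta_fun m.+1 n.+1 =
      (\int[lebesgue_measure]_(t in `[0, 1]) (t ^+ m * (1 - t) ^+ n))%R :> R.
    by rewrite /beta_fun -Rintegral_mkcond.
  rewrite Rintegral_monem // -/F subrr F0 in E.
  have := mulfI B0 (etrans (mulr1 _) E); lra.
rewrite /betainc Rintegral_monem ?subr_gt0 // -/F F1 subr0 mulrC mulKf //.
by rewrite opprB addrC subrK.
Qed.

End IncompleteBeta.

(** * Asymptotic expansions in 1/N *)

Section Expansions.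
Variable R : realType.
Implicit Types (f g r : nat -> R) (a b c : R).

(** The strict inequality makes every [N] in range positive, so that [N%:R^-1] is a genuine
    inverse. *)
Definition eventually_bounded r :=
  exists C : R, exists N0 : nat, forall N, (N0 < N)%N -> `|r N| <= C.

Lemma eventually_bounded_cst a : eventually_bounded (fun _ => a).
Proof. by exists `|a|, 0%N. Qed.

Lemma eventually_bounded_inv_nat : eventually_bounded (fun N => N%:R^-1).
Proof.
exists 1, 0%N => N N0.
by rewrite ger0_norm ?invr_ge0 // invf_le1 ?ltr0n // ler1n.
Qed.

Lemma eventually_boundedD f g :
  eventually_bounded f -> eventually_bounded g ->
  eventually_bounded (fun N => f N + g N).
Proof.
move=> [C [N1 fC]] [D [N2 gD]]; exists (C + D), (maxn N1 N2) => N.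
rewrite gtn_max => /andP[N1N N2N].
by apply: le_trans (ler_normD _ _) _; rewrite lerD ?fC ?gD.
Qed.

Lemma eventually_boundedM f g :
  eventually_bounded f -> eventually_bounded g ->
  eventually_bounded (fun N => f N * g N).
Proof.
move=> [C [N1 fC]] [D [N2 gD]]; exists (C * D), (maxn N1 N2) => N.
rewrite gtn_max => /andP[N1N N2N].
by rewrite normrM ler_pM ?fC ?gD.
Qed.

(* [expansion f a b] reads [f N = a + b / N + O (1 / N ^ 2)]. *)
Definition expansion f a b :=
  exists r, eventually_bounded r /\
  exists N0 : nat, forall N, (N0 < N)%N ->
    f N = a + b * N%:R^-1 + r N * N%:R^-1 ^+ 2.

Lemma expansion_eq f g a b a' b' : expansion f a b ->
  (exists N0 : nat, forall N, (N0 < N)%N -> f N = g N) -> a = a' -> b = b' ->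
  expansion g a' b'.
Proof.
move=> [r [br [N0 fE]]] [N1 fg] <- <-; exists r; split => //.
exists (maxn N0 N1) => N; rewrite gtn_max => /andP[N0N N1N].
by rewrite -fg // fE.
Qed.

Lemma expansion_cst a : expansion (fun _ => a) a 0.
Proof.
exists (fun _ => 0); split; first exact: eventually_bounded_cst.
by exists 0%N => N _; rewrite !mul0r !addr0.
Qed.

Lemma expansion_inv_nat : expansion (fun N => N%:R^-1) 0 1.
Proof.
exists (fun _ => 0); split; first exact: eventually_bounded_cst.
by exists 0%N => N _; rewrite mul0r mul1r addr0 add0r.
Qed.

Lemma expansionD f g a b a' b' :
  expansion f a b -> expansion g a' b' ->
  expansion (fun N => f N + g N) (a + a') (b + b').
Proof.
move=> [r [br [N1 fE]]] [r' [br' [N2 gE]]].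
exists (fun N => r N + r' N); split; first exact: eventually_boundedD.
exists (maxn N1 N2) => N; rewrite gtn_max => /andP[N1N N2N].
by rewrite fE // gE //; ring.
Qed.

Lemma expansionM f g a b a' b' :
  expansion f a b -> expansion g a' b' ->
  expansion (fun N => f N * g N) (a * a') (a * b' + b * a').
Proof.
move=> [r [br [N1 fE]]] [r' [br' [N2 gE]]].
exists (fun N => a * r' N + r N * a' + b * b' +
  N%:R^-1 * (b * r' N + r N * b') + N%:R^-1 * N%:R^-1 * (r N * r' N)).
split.
  by repeat first [exact: eventually_bounded_cst
    | exact: eventually_bounded_inv_nat | exact: br | exact: br'
    | apply: eventually_boundedD | apply: eventually_boundedM].
exists (maxn N1 N2) => N; rewrite gtn_max => /andP[N1N N2N].
by rewrite fE // gE //; move: (N%:R^-1) => h; ring.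
Qed.

(** With [u] the expected first-order inverse and h = 1/N, one has [f N * u = 1 - K * h ^+ 2], so
    the remainder is [K / f N]. It is bounded because [f N] stays away from 0. *)
Lemma expansionV f a b : a != 0 -> expansion f a b ->
  expansion (fun N => (f N)^-1) a^-1 (- b / a ^+ 2).
Proof.
move=> a0 [r [br [N1 fE]]].
have /(eventually_boundedD (eventually_bounded_cst b)) [C [N2 bC]] :=
  eventually_boundedM br eventually_bounded_inv_nat.
have na0 : 0 < `|a| by rewrite normr_gt0.
(* [C] bounds [b + r N / N]; beyond [N3], [C / N] is less than half of the absolute value of [a]. *)
pose N3 := Num.bound (2 * C / `|a|).
have fge N : (maxn N1 (maxn N2 N3) < N)%N -> `|a| / 2 <= `|f N|.
  rewrite !gtn_max => /and3P[N1N N2N N3N].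
  have N0 : 0 < N%:R :> R by rewrite ltr0n (leq_trans _ N3N).
  have -> : f N = a + (b + r N * N%:R^-1) * N%:R^-1.
    by rewrite fE //; move: (N%:R^-1) => h; ring.
  apply: le_trans (lerB_normD _ _); rewrite normrM.
  have : `|b + r N * N%:R^-1| * `|N%:R^-1| <= `|a| / 2; last by lra.
  rewrite [`|_^-1|]ger0_norm ?invr_ge0 // ler_pdivrMr //.
  apply: le_trans (bC _ N2N) _.
  have C0 : 0 <= C by apply: le_trans (bC _ N2N).
  have : 2 * C / `|a| < N%:R.
    apply: lt_le_trans (archi_boundP _) _; last by rewrite ler_nat ltnW.
    by rewrite !mulr_ge0 ?invr_ge0.
  rewrite ltr_pdivrMr //; lra.
exists (fun N => (b ^+ 2 / a ^+ 2 + - 1 * r N * (a^-1 + - b / a ^+ 2 * N%:R^-1)) *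
                 (f N)^-1); split.
  apply: eventually_boundedM; last first.
    exists (`|a| / 2)^-1, (maxn N1 (maxn N2 N3)) => N /fge H.
    have ap : 0 < `|a| / 2 by rewrite divr_gt0.
    by rewrite normfV lef_pV2 // posrE // (lt_le_trans ap).
  by repeat first [exact: eventually_bounded_cst
    | exact: eventually_bounded_inv_nat | exact: br
    | apply: eventually_boundedD | apply: eventually_boundedM].
exists (maxn N1 (maxn N2 N3)) => N NN.
have f0 : f N != 0.
  by rewrite -normr_gt0 (lt_le_trans _ (fge _ NN)) // divr_gt0.
move: NN; rewrite !gtn_max => /and3P[N1N _ _].
set h := N%:R^-1; set v := (f N)^-1; set u := a^-1 + _ * h; set K := _ + _ * u.
have fu : f N * u + K * h ^+ 2 = 1.
  by rewrite fE // -/h /K /u; field.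
have vf : v * f N = 1 by exact: mulVf.
move: v u K vf fu => v u K vf fu.
transitivity (v * (f N * u + K * h ^+ 2)); first by rewrite fu mulr1.
by rewrite mulrDr [v * (f N * u)]mulrA vf mul1r; ring.
Qed.

(** The upper bound combines [expR x * (1 - x) <= 1] with (1 - x) (1 + x + 2 x^2) >= 1, valid for x
    <= 1/2. *)
Lemma expR_taylor1 (x : R) : `|x| <= 2^-1 ->
  0 <= expR x - 1 - x <= 2 * x ^+ 2.
Proof.
rewrite ler_norml => /andP[x1 x2]; apply/andP; split.
  by have := expR_ge1Dx x; lra.
have := expR_ge1Dx (- x).
have : expR x * expR (- x) = 1 by rewrite expRN mulfV ?gt_eqF ?expR_gt0.
have := expR_gt0 x; move: (expR x) (expR (- x)) => e e' e0 ee ge.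
have h : e * (1 - x) <= 1 by rewrite -[leRHS]ee ler_pM2l.
have : (1 - x) * (1 + x + 2 * x ^+ 2) - 1 = x ^+ 2 * (1 - 2 * x) by ring.
have : 0 <= x ^+ 2 * (1 - 2 * x) by rewrite mulr_ge0 ?sqr_ge0 //; lra.
move=> k1 k2; have : e <= 1 + x + 2 * x ^+ 2; last by lra.
rewrite -(@ler_pM2r _ (1 - x)); lra.
Qed.

(** The mean value theorem for the Taylor remainder, whose derivative [expR t - 1 - t] is controlled
    by [expR_taylor1]. *)
Lemma expR_taylor2 (x : R) : `|x| <= 2^-1 ->
  `|expR x - 1 - x - x ^+ 2 / 2| <= 2 * `|x| ^+ 3.
Proof.
move=> x2.
pose P : {poly R} := 1 + 'X + 2^-1 *: 'X^2.
pose g := expR \- horner P.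
have dg (t : R) : is_derive t (1 : R) g (expR t - P^`().[t]) by exact: is_deriveB.
have P'E t : P^`().[t] = 1 + t.
  rewrite /P !derivD derivC derivZ derivX derivXn !hornerE /=; lra.
have gE : expR x - 1 - x - x ^+ 2 / 2 = g x - g 0.
  by rewrite /g /= expR0 /P !hornerE /=; field.
have bnd t : `|t| <= `|x| -> `|expR t - P^`().[t]| <= 2 * `|x| ^+ 2.
  move=> tx; rewrite P'E opprD addrA.
  have /andP[t0 t1] := expR_taylor1 (le_trans tx x2).
  rewrite ger0_norm //; apply: le_trans t1 _.
  by rewrite ler_pM2l // -real_normK ?num_real // lerXn2r ?nnegrE.
have cg A : {within A, continuous g}%classic.
  apply: continuous_subspaceT => t.
  by apply/differentiable_continuous/derivable1_diffP; have [] := dg t.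
rewrite gE exprSr mulrA.
have [x0|/ltW x0] := leP 0 x.
  have [t tI ->] := MVT_segment x0 (fun t _ => dg t) (cg _).
  rewrite subr0 normrM ler_wpM2r // bnd //.
  by move: tI; rewrite in_itv /= => /andP[t0 tx]; rewrite !ger0_norm.
have [t tI e] := MVT_segment x0 (fun t _ => dg t) (cg _).
rewrite -normrN opprB e sub0r normrM normrN ler_wpM2r // bnd //.
by move: tI; rewrite in_itv /= => /andP[tx t0]; rewrite !ler0_norm // lerN2.
Qed.

(** The prefactor [N] costs one order, so the exponential is needed up to a cubic error. *)
Lemma expansion_oneB_expR (c : R) :
  expansion (fun N => N%:R * (1 - expR (- c / N%:R))) c (- c ^+ 2 / 2).
Proof.
pose g (x : R) := expR x - 1 - x - x ^+ 2 / 2.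
pose N1 := Num.bound (2 * `|c|).
exists (fun N => - (N%:R ^+ 3 * g (- c / N%:R))); split; last first.
  exists 0%N => N N0; rewrite /g.
  have : N%:R != 0 :> R by rewrite pnatr_eq0 -lt0n.
  by move: (expR (- c / N%:R)) (N%:R : R) => e x x0; field.
(* Beyond [N1] the argument [- c / N] is at most 1/2 in absolute value, as the Taylor bound
   requires. *)
exists (2 * `|c| ^+ 3), N1 => N NN.
have N0 : 0 < N%:R :> R by rewrite ltr0n (leq_trans _ NN).
have E : `|- c / N%:R| = `|c| / N%:R.
  by rewrite normrM normrN normfV (ger0_norm (ltW N0)).
have /expR_taylor2 : `|- c / N%:R| <= 2^-1.
  rewrite E ler_pdivrMr // mulrC ler_pdivlMr // mulrC ltW //.
  apply: lt_le_trans (archi_boundP _) _; last by rewrite ler_nat ltnW.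
  by rewrite mulr_ge0.
rewrite -/(g _) E normrN normrM expr_div_n mulrA ler_pdivlMr ?exprn_gt0 //.
by rewrite mulrC ger0_norm // exprn_ge0 // ltW.
Qed.

Lemma expansion_expR (c : R) : expansion (fun N => expR (- c / N%:R)) 1 (- c).
Proof.
apply: expansion_eq (expansionD (expansion_cst 1) (expansionM
  (expansion_cst (- 1)) (expansionM expansion_inv_nat (expansion_oneB_expR c)))) _ _ _.
- exists 0%N => N N0.
  by rewrite mulN1r mulKf ?pnatr_eq0 -?lt0n // opprB addrC subrK.
- by rewrite mul0r mulr0 addr0.
- by ring.
Qed.

Lemma expansion_sum (I : Type) (s : seq I) (F : I -> nat -> R) (a b : I -> R) :
  (forall i, expansion (F i) (a i) (b i)) ->
  expansion (fun N => \sum_(i <- s) F i N) (\sum_(i <- s) a i) (\sum_(i <- s) b i).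
Proof.
move=> E; elim: s => [|i s IH].
  by rewrite !big_nil; under eq_fun do rewrite big_nil; exact: expansion_cst.
rewrite !big_cons; under eq_fun do rewrite big_cons; exact: expansionD.
Qed.

End Expansions.

(** * Expansions of q-Pochhammer symbols and of their coefficients *)

Section MomentExpansion.
Variable R : realType.
Implicit Types (f : nat -> R) (a b : R).

Definition poly_expansion (P : nat -> {poly R}) (A B : {poly R}) :=
  forall j, expansion (fun N => (P N)`_j) A`_j B`_j.

Lemma poly_expansionM (P Q : nat -> {poly R}) (A B C D : {poly R}) :
  poly_expansion P A B -> poly_expansion Q C D ->
  poly_expansion (fun N => P N * Q N) (A * C) (A * D + B * C).
Proof.
move=> PE QE j; have H (i : 'I_j.+1) := expansionM (PE i) (QE (j - i)%N).
apply: expansion_eq (expansion_sum (index_enum _) H) _ _ _.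
- by exists 0%N => N _; rewrite coefM.
- by rewrite coefM.
- by rewrite coefD !coefM -big_split.
Qed.

Lemma poly_expansion_linear f a b : expansion f a b ->
  poly_expansion (fun N => 1 - f N *: 'X) (1 - a *: 'X) (- b *: 'X).
Proof.
move=> fE j.
apply: expansion_eq (expansionD (expansion_cst (1%:P : {poly R})`_j)
  (expansionM (expansion_cst (- ('X : {poly R})`_j)) fE)) _ _ _.
- by exists 0%N => N _; rewrite coefB coefZ polyC1; ring.
- by rewrite coefB coefZ polyC1; ring.
- by rewrite coefZ; ring.
Qed.

Variable lam : R.
Hypothesis lam0 : 0 < lam.

Let q (N : nat) : R := expR (- lam / N%:R).

Let oneB_q_expansion (v j : nat) :
  expansion (fun N => N%:R * (1 - q N ^+ v / q N ^+ j))
    (lam * (v%:R - j%:R)) (- (lam * (v%:R - j%:R)) ^+ 2 / 2).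
Proof.
apply: expansion_eq (expansion_oneB_expR _) _ erefl erefl.
exists 0%N => N _; congr (_ * (1 - _)).
by rewrite /q -!expRM_natr -expRB; congr expR; ring.
Qed.

(** The relative correction [j * lam / 2] does not depend on [v], so a product of [n] such ratios
    simply multiplies it by [n]. *)
Let oneB_q_ratio_expansion (v j : nat) : (0 < v)%N ->
  expansion (fun N => (1 - q N ^+ v / q N ^+ j) / (1 - q N ^+ v))
    ((v%:R - j%:R) / v%:R) ((v%:R - j%:R) / v%:R * (j%:R * lam / 2)).
Proof.
move=> v0; have vN0 : v%:R != 0 :> R by rewrite pnatr_eq0 -lt0n.
have lamN0 : lam != 0 by rewrite gt_eqF.
have den0 : lam * (v%:R - 0%:R) != 0 by rewrite subr0 mulf_neq0.
apply: expansion_eq (expansionM (oneB_q_expansion v j)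
  (expansionV den0 (oneB_q_expansion v 0))) _ _ _.
- exists 0%N => N N0; rewrite expr0 divr1 -mulf_div divff ?mul1r //.
  by rewrite pnatr_eq0 -lt0n.
- by field; rewrite vN0 lamN0.
- by field; rewrite vN0 lamN0.
Qed.

Lemma qpoch_ratio_expansion (n j : nat) :
  expansion (fun N => qpoch (q N / q N ^+ j) (q N) n / qpoch (q N) (q N) n)
    (binom_weight R n j) (binom_weight R n j * (n%:R * (j%:R * lam / 2))).
Proof.
elim: n => [|n IH].
  apply: expansion_eq (expansion_cst 1) _ _ _.
  - by exists 0%N => N _; rewrite /qpoch !big_ord0 divr1.
  - by rewrite /binom_weight big_ord0.
  - by rewrite mul0r mulr0.
apply: expansion_eq (expansionM IH (oneB_q_ratio_expansion j (ltn0Sn n))) _ _ _.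
- exists 0%N => N _; rewrite /qpoch !big_ord_recr /= -mulf_div; congr (_ * (_ / _)).
    by rewrite exprS; ring.
  by rewrite exprS.
- by rewrite /binom_weight big_ord_recr.
- by rewrite /binom_weight big_ord_recr /= -natr1; ring.
Qed.

(** The factor of index [t] has slope s - lam s (d + t) / N + O(1/N^2); the 1/N term collects these
    by the product rule. For [k = 0] the empty sum makes the exponent [k.-1] harmless. *)
Lemma qpoch_poly_expansion (f : nat -> R) (s d : R) (k : nat) :
  expansion f s (- s * lam * d) ->
  poly_expansion (fun N => qpoch_poly (q N) (f N) k)
    ((1 - s *: 'X) ^+ k)
    ((lam * s * \sum_(t < k) (d + t%:R)) *: ('X * (1 - s *: 'X) ^+ k.-1)).
Proof.
move=> fE; elim: k => [|k IH].
  move=> j; rewrite big_ord0 mulr0 scale0r coef0.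
  apply: expansion_eq (expansion_cst (1%:P : {poly R})`_j) _ _ erefl.
  - by exists 0%N => N _; rewrite /qpoch_poly big_ord0.
  - by rewrite expr0.
have E : expansion (fun N => f N * q N ^+ k) s (- (lam * s * (d + k%:R))).
  apply: expansion_eq (expansionM fE (expansion_expR (lam * k%:R))) _ _ _.
  - exists 0%N => N _; congr (_ * _).
    by rewrite /q -expRM_natr; congr expR; ring.
  - by rewrite mulr1.
  - by ring.
have H := poly_expansionM IH (poly_expansion_linear E).
move=> j; apply: expansion_eq (H j) _ _ _.
- by exists 0%N => N _; rewrite qpoch_polyS.
- by rewrite exprSr.
- apply: (congr1 (fun P : {poly R} => P`_j)); rewrite opprK big_ord_recr /=.
  case: k {IH E H} => [|k] /=.
    by rewrite !big_ord0 !mulr0 !scale0r mul0r !add0r expr0 mul1r mulr1 addr0.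
  rewrite -!mul_polyC; move: (1 - s%:P * 'X : {poly R}) => L.
  by rewrite mulrDr polyCD exprS; ring.
Qed.

End MomentExpansion.

(** * Algebra of the limiting functional *)

Section BetaPolyLinear.
Variable R : realType.
Implicit Types P Q : {poly R}.

Lemma beta_polyZ n (k : R) P : beta_poly n (k *: P) = k *: beta_poly n P.
Proof.
by apply/polyP => j; rewrite coefZ !coef_beta_poly coefZ; ring.
Qed.

Lemma beta_poly_sum n (I : Type) (r : seq I) (P : I -> {poly R}) :
  beta_poly n (\sum_(i <- r) P i) = \sum_(i <- r) beta_poly n (P i).
Proof.
apply/polyP => j; rewrite coef_beta_poly !coef_sum big_distrr /=.
by apply: eq_bigr => i _; rewrite coef_beta_poly.
Qed.

(** Both operators are diagonal on monomials, hence commute. *)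
Lemma beta_poly_Xderiv n P :
  beta_poly n ('X * P^`()) = 'X * (beta_poly n P)^`().
Proof.
apply/polyP => -[|j]; rewrite coef_beta_poly !coefXM /= ?mulr0 //.
by rewrite !coef_deriv coef_beta_poly mulrnAr.
Qed.

(** Writing [1 - x *: 'X] as [(1 - x) + x (1 - 'X)] and expanding gives powers of [1 - 'X], each
    sent to an incomplete beta function. *)
Lemma beta_poly_binomial n p (x s : R) : s < 1 ->
  (beta_poly n ((1 - 'X) ^+ n.+1 * (1 - x *: 'X) ^+ p)).[s] =
  \sum_(m < p.+1) 'C(p, m)%:R * x ^+ m * (1 - x) ^+ (p - m) *
                  betainc (1 - s) m.+1 n.+1.
Proof.
move=> s1.
have -> : 1 - x *: 'X = (1 - x)%:P + x *: (1 - 'X) :> {poly R}.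
  by rewrite -!mul_polyC polyCB; ring.
rewrite [(_%:P + _) ^+ p]exprDn big_distrr /= beta_poly_sum horner_sum.
apply: eq_bigr => m _.
rewrite betaincE // exprZn -[(1 - x)%:P ^+ _]polyC_exp mul_polyC scalerA.
rewrite -scaler_nat scalerA -scalerAr -exprD beta_polyZ hornerZ.
by congr (_ * _); ring.
Qed.

End BetaPolyLinear.

(** * The expansion of m_(N,p) / N up to O(1/N^2) *)

Section MainExpansion.
Variables (R : realType) (lam c : R) (d n : nat).
Hypothesis lam0 : 0 < lam.

Let p := n.+1.
Let s : R := expR (- lam).
Let sig : R := s `^ c.
Let q (N : nat) : R := expR (- lam / N%:R).
(** [A] is the limit of (x;q)_p (q^alpha x;q)_p and [B] its coefficient of 1/N. The scalars 1 and 0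
    keep the shape that [qpoch_poly_expansion] gives for the first factor. *)
Let A : {poly R} := (1 - 1 *: 'X) ^+ p * (1 - sig *: 'X) ^+ p.
Let B : {poly R} :=
  (1 - 1 *: 'X) ^+ p *
    ((lam * sig * \sum_(t < p) (d%:R + t%:R)) *: ('X * (1 - sig *: 'X) ^+ n)) +
  ((lam * 1 * \sum_(t < p) (0 + t%:R)) *: ('X * (1 - 1 *: 'X) ^+ n)) *
    (1 - sig *: 'X) ^+ p.

(* The coefficient of [1 / N] in the expansion of [m_(N,p) / N]. *)
Definition moment_correction : R :=
  2^-1 * (beta_poly n A).[s] +
  (lam * p%:R)^-1 * ((beta_poly n B).[s] +
                     n%:R * lam / 2 * (s * (beta_poly n A)^`().[s])).

Let pN0 : (p%:R : R) != 0. Proof. by rewrite pnatr_eq0. Qed.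

Let lim_eq : (lam * p%:R)^-1 * (beta_poly n A).[s] = Mq c lam p.
Proof.
rewrite /Mq -/s -/sig; congr (_ * _); rewrite /A scale1r beta_poly_binomial //.
by rewrite expR_lt1 oppr_lt0.
Qed.

Let lamp_neq0 : lam * p%:R != 0.
Proof. by rewrite mulf_neq0 ?gt_eqF. Qed.

(* Any bound on all the degrees involved will do. *)
Let K := maxn p.*2.+1 (maxn (size A) (maxn (size B) (size ('X * A^`())))).

(** The last factor of (q;q)_p absorbs the division by [N]; the other [n] factors normalise
    (q^(1-j);q)_n. *)
Let pref_expansion :
  expansion (fun N => (N%:R * (1 - q N ^+ p))^-1) (lam * p%:R)^-1 2^-1.
Proof.
apply: expansion_eq (expansionV lamp_neq0 (expansion_oneB_expR (lam * p%:R))) _ _ _.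
- exists 0%N => N _; rewrite /q -expRM_natr; congr (_ * (1 - expR _))^-1; ring.
- by [].
- by field; rewrite (gt_eqF lam0) pN0.
Qed.

Let sum_expansion :
  expansion (fun N => \sum_(j < K)
      (qpoch_poly (q N) 1 p * qpoch_poly (q N) (sig * expR (- (lam * d%:R) / N%:R)) p)`_j
      * s ^+ j * (qpoch (q N / q N ^+ j) (q N) n / qpoch (q N) (q N) n))
    (beta_poly n A).[s]
    ((beta_poly n B).[s] + n%:R * lam / 2 * (s * (beta_poly n A)^`().[s])).
Proof.
have one : expansion (fun _ => 1) 1 (- 1 * lam * 0).
  by apply: expansion_eq (expansion_cst 1) _ _ _; rewrite ?mulr0 //; exists 0%N.
have sigE : expansion (fun N => sig * expR (- (lam * d%:R) / N%:R)) sig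
    (- sig * lam * d%:R).
  apply: expansion_eq (expansionM (expansion_cst sig) (expansion_expR _)) _ _ _.
  - by exists 0%N.
  - by rewrite mulr1.
  - by ring.
have GE : poly_expansion _ A B :=
  poly_expansionM (qpoch_poly_expansion p one) (qpoch_poly_expansion p sigE).
have H (j : 'I_K) := expansionM (expansionM (GE j) (expansion_cst (s ^+ j)))
  (qpoch_ratio_expansion lam0 n j).
have szA : (size A <= K)%N by rewrite /K !leq_max leqnn !orbT.
have szB : (size B <= K)%N by rewrite /K !leq_max leqnn !orbT.
have szA' : (size ('X * A^`())%R <= K)%N by rewrite /K !leq_max leqnn !orbT.
apply: expansion_eq (expansion_sum (index_enum _) H) _ _ _.
- by exists 0%N.
- rewrite (horner_beta_poly _ _ szA); apply: eq_bigr => j _; rewrite /A; ring.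
- have -> : s * (beta_poly n A)^`().[s] = ('X * (beta_poly n A)^`()).[s].
    by rewrite !hornerE.
  rewrite -beta_poly_Xderiv (horner_beta_poly _ _ szB) (horner_beta_poly _ _ szA').
  rewrite big_distrr -big_split /=; apply: eq_bigr => j _.
  (* The factor [j] in the correction of the Pochhammer ratio acts as the operator ['X] d/d['X] on
     [A]. *)
  have -> : ('X * A^`())`_j = j%:R * A`_j.
    rewrite coefXM; case: (nat_of_ord j) => [|i] /=; first by rewrite mul0r.
    by rewrite coef_deriv mulr_natl.
  rewrite -/A -/B; ring.
Qed.

(** The function [f] is defined for all [N] and does not mention [a], so the expansion makes sense
    although the moment is only considered where [c * N + d] is an integer. *)
Lemma moment_expansion :
  exists f, expansion f (Mq c lam p) moment_correction /\
  forall N a : nat, (n < N)%N -> c * N%:R + d%:R = a%:R ->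
    qLUE_moment N a (q N) p / N%:R = f N.
Proof.
eexists; split.
  apply: expansion_eq (expansionM pref_expansion sum_expansion) _ _ _.
  - by exists 0%N.
  - exact: lim_eq.
  - by rewrite /moment_correction addrC.
move=> N a nN aE /=.
have N0 : N%:R != 0 :> R by rewrite pnatr_eq0 -lt0n (leq_trans _ nN).
have q01 : 0 < q N < 1.
  rewrite /q expR_gt0 expR_lt1 mulNr oppr_lt0 divr_gt0 //.
  by rewrite ltr0n (leq_trans _ nN).
rewrite (@qLUE_moment_resummed _ _ _ q01 _ _ K) //; last by rewrite /K leq_max leqnn.
have -> : q N ^+ N = s.
  by rewrite /q -expRM_natr /s; congr expR; field.
have -> : q N ^+ a = sig * expR (- (lam * d%:R) / N%:R).
  rewrite /q -expRM_natr /sig /s -expRM -expRD; congr expR.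
  by rewrite -aE; field.
have -> : qpoch (q N) (q N) p = qpoch (q N) (q N) n * (1 - q N ^+ p).
  by rewrite /qpoch big_ord_recr /= -exprS.
rewrite !invfM.
under [in RHS]eq_bigr do rewrite mulrA.
rewrite -big_distrl /=; ring.
Qed.

End MainExpansion.

(** * Closed form of the correction for c = 0 *)

Section CorrectionAtZero.
Variables (R : realType) (lam : R) (d n : nat).
Hypothesis lam0 : 0 < lam.

Let s : R := expR (- lam).

Let sum_ord (k : nat) : \sum_(t < k) (t%:R : R) = k%:R * (k%:R - 1) / 2.
Proof.
elim: k => [|k IH]; first by rewrite big_ord0 !mul0r.
by rewrite big_ord_recr /= IH -natr1; field.
Qed.

Lemma moment_correction0 :
  moment_correction lam 0 d n =
  2^-1 * betainc (1 - s) n.+2 n.+1 +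
  d%:R / 2 * 'C(2 * n.+1, n.+1)%:R * s ^+ n.+1 * (1 - s) ^+ n.+1.
Proof.
have s1 : s < 1 by rewrite expR_lt1 oppr_lt0.
have lamN0 : lam != 0 by rewrite gt_eqF.
have pN0 : n.+1%:R != 0 :> R by rewrite pnatr_eq0.
rewrite /moment_correction -/s powRr0 scale1r betaincE // -exprD.
set A : {poly R} := (1 - 'X) ^+ (n.+1 + n.+1).
set B : {poly R} := _ + _ * (1 - 'X) ^+ n.+1.
have BE : B = (- (lam * (n%:R + d%:R) / 2)) *: ('X * A^`()).
  have -> : A^`() = (- (2 * n.+1%:R)) *: (1 - 'X) ^+ (n + n.+1).
    rewrite /A deriv_exp derivB derivC derivX sub0r mulN1r addSn /=.
    rewrite -scaler_nat scalerN -scaleNr; congr (- _ *: _).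
    by rewrite -addSn natrD; ring.
  rewrite -scalerAr scalerA /B.
  have E (k l : R) (L M X : {poly R}) :
      M * (k *: (X * L)) + (l *: (X * L)) * M = (k + l) *: (X * (L * M)).
    by rewrite -!mul_polyC polyCD; ring.
  rewrite exprD E; congr (_ *: _); under [X in _ + _ * X]eq_bigr do rewrite add0r.
  rewrite big_split /= sumr_const card_ord sum_ord -[_ *+ n.+1]mulr_natr -natr1.
  by field.
have -> : (beta_poly n B).[s] =
    - (lam * (n%:R + d%:R) / 2) * (s * (beta_poly n A)^`().[s]).
  by rewrite BE beta_polyZ hornerZ beta_poly_Xderiv [('X * _).[s]]hornerM hornerX.
have -> : (beta_poly n A)^`().[s] =
    - (n.+1%:R * 'C(2 * n.+1, n.+1)%:R) * (s ^+ n * (1 - s) ^+ n.+1).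
  have hE : ('X^n * (1 - 'X) ^+ n.+1).[s] = s ^+ n * (1 - s) ^+ n.+1.
    by rewrite !hornerE.
  rewrite deriv_beta_poly_1subX hornerZ hE; congr (- _ * _).
  rewrite beta_fun_fact invf_div mul2n -addnn.
  have /(congr1 (fun k => k%:R : R)) := bin_fact (leq_addr n.+1 n.+1).
  rewrite addKn addSn addnS addSn => <-.
  rewrite factS !natrM.
  have f0 : (n`!%:R : R) != 0 by rewrite pnatr_eq0 -lt0n fact_gt0.
  by field; rewrite f0 nat1r pN0.
rewrite [s ^+ n.+1]exprS; field.
by rewrite lamN0 nat1r pN0.
Qed.

End CorrectionAtZero.

(** * The limit, and the refined expansion for c = 0 *)

Unset Implicit Arguments.

Theorem theorem1p1 (R : realType) (c : R) (d : nat) (lam : R) :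
  0 <= c -> 0 < lam ->
  (forall p : nat, (1 <= p)%N ->
     forall eps : R, 0 < eps ->
     exists N0 : nat, forall N a : nat, (N0 <= N)%N ->
       c * N%:R + d%:R = a%:R ->
       `| qLUE_moment N a (expR (- lam / N%:R)) p / N%:R - Mq c lam p | < eps)
  /\
  (c = 0 ->
   forall p : nat, (1 <= p)%N ->
     exists C : R, exists N0 : nat, forall N : nat, (N0 <= N)%N ->
       `| qLUE_moment N d (expR (- lam / N%:R)) p
          - (N%:R * Mq 0 lam p
             + 2^-1 * betainc (1 - expR (- lam)) p.+1 p
             + d%:R / 2 * 'C(2 * p, p)%:R * expR (- lam) ^+ p
                 * (1 - expR (- lam)) ^+ p) | <= C / N%:R).
Proof.
move=> _ lam0; split=> [|c0] [//|n] _.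
  move=> eps eps0.
  have [f [[r [br [N1 fE]]] mE]] := moment_expansion c d n lam0.
  (* [C] bounds [N] times the distance to the limit, so [N > C / eps] suffices. *)
  have [C [N2 bC]] := eventually_boundedD
    (eventually_bounded_cst (moment_correction lam c d n))
    (eventually_boundedM br (@eventually_bounded_inv_nat R)).
  exists (maxn n (maxn N1 (maxn N2 (Num.bound (C / eps))))).+1 => N a.
  rewrite !gtn_max => /and4P[nN N1N N2N N3N] /(mE _ _ nN) ->.
  have Np : 0 < N%:R :> R by rewrite ltr0n (leq_trans _ nN).
  rewrite fE //.
  set b := moment_correction _ _ _ _; set h := N%:R^-1.
  have -> : Mq c lam n.+1 + b * h + r N * h ^+ 2 - Mq c lam n.+1 =
            (b + r N * h) * h by ring.
  rewrite normrM [`|h|]ger0_norm ?invr_ge0 // ltr_pdivrMr //.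
  apply: le_lt_trans (bC _ N2N) _.
  have C0 : 0 <= C := le_trans (normr_ge0 _) (bC _ N2N).
  rewrite mulrC -ltr_pdivrMr //.
  apply: lt_le_trans (archi_boundP _) _; last by rewrite ler_nat ltnW.
  by rewrite divr_ge0 // ltW.
have [f [[r [[C [N2 bC]] [N1 fE]]] mE]] := moment_expansion 0 d n lam0.
exists C, (maxn n (maxn N1 N2)).+1 => N.
rewrite !gtn_max => /and3P[nN N1N N2N].
have Np : 0 < N%:R :> R by rewrite ltr0n (leq_trans _ nN).
have := mE N d nN; rewrite mul0r add0r => /(_ erefl).
rewrite fE // (moment_correction0 d n lam0) => /(canRL (divfK (lt0r_neq0 Np))) ->.
set x := 2^-1 * _; set y := d%:R / 2 * _ * _ * _.
(* Multiplying the expansion back by [N] turns its 1/N coefficient into the constant term and its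
   remainder into [r N / N]. *)
have -> : (Mq 0 lam n.+1 + (x + y) * N%:R^-1 + r N * N%:R^-1 ^+ 2) * N%:R -
    (N%:R * Mq 0 lam n.+1 + x + y) = r N / N%:R.
  by field; rewrite gt_eqF.
by rewrite normrM normfV (ger0_norm (ltW Np)) ler_pM2r ?invr_gt0 // bC.
Qed.
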